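(* Let $f\colon\{0,1\}^n\to[-1,1]$ be a product test with $k$ functions of input length $m$, i.e., $f(x)=\prod_{i=1}^k f_i(x_{I_i})$ where $I_1,\dots,I_k\subseteq[n]$ are pairwise disjoint of size at most $m$ and each $f_i$ has range in $[-1,1]$. Let $d$ be a positive integer. Let $D$ and $T$ be two independent $\delta$-almost $d$-wise independent distributions over $\{0,1\}^n$, and let $U$ be the uniform distribution over $\{0,1\}^n$, independent of $D,T$. Then \[ \bigl|\mathbb{E}[f(D+T\wedge U)]-\mathbb{E}[f(U)]\bigr|\le k\cdot\Bigl(\sqrt{\delta}\cdot\bigl(170\sqrt{m\ln(ek)}\bigr)^d+2^{-(d-m)/2}\Bigr), \] where $+$ and $\wedge$ are bitwise XOR and AND.
   Context: A distribution $D$ on $\{0,1\}^n$ is $\delta$-almost $d$-wise independent if for every set $S\subseteq[n]$ of at most $d$ coordinates, the marginal of $D$ on $S$ is within statistical distance $\delta$ of the uniform distribution on $\{0,1\}^S$. $x_I$ denotes the bits of $x$ indexed by $I$. *)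

(* Defs.v *)
From mathcomp Require Import all_boot all_order all_algebra.
From mathcomp Require Import all_classical all_reals all_analysis.

Set Implicit Arguments.
Unset Strict Implicit.
Unset Printing Implicit Defensive.

Import Order.TTheory GRing.Theory Num.Theory.

Local Open Scope ring_scope.

Record fdist (R : realType) (A : finType) := FDist {
  pmf :> A -> R;
  pmf_ge0 : forall a, 0 <= pmf a;
  pmf_sum1 : \sum_a pmf a = 1
}.

Definition expect (R : realType) (A : finType) (P : fdist R A) (g : A -> R) : R :=
  \sum_a P a * g a.

Section Constructions.
Variable R : realType.

Lemma fmap_ge0 (A B : finType) (h : A -> B) (P : fdist R A) (b : B) :
  0 <= \sum_(a | h a == b) P a.
Proof. by apply: sumr_ge0 => a _; exact: pmf_ge0. Qed.

Lemma fmap_sum1 (A B : finType) (h : A -> B) (P : fdist R A) :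
  \sum_b \sum_(a | h a == b) P a = 1.
Proof.
rewrite -(pmf_sum1 P) (partition_big h predT) //=.
Qed.

(* The law of h(X) when X has law P. *)
Definition fmap (A B : finType) (h : A -> B) (P : fdist R A) : fdist R B :=
  FDist (fmap_ge0 h P) (fmap_sum1 h P).

Lemma fprod_ge0 (A B : finType) (P : fdist R A) (Q : fdist R B) (ab : A * B) :
  0 <= P ab.1 * Q ab.2.
Proof. by apply: mulr_ge0; exact: pmf_ge0. Qed.

Lemma fprod_sum1 (A B : finType) (P : fdist R A) (Q : fdist R B) :
  \sum_(ab : A * B) P ab.1 * Q ab.2 = 1.
Proof.
rewrite -(pair_bigA _ (fun a b => P a * Q b)) /= -(pmf_sum1 P).
by apply: eq_bigr => a _; rewrite -mulr_sumr pmf_sum1 mulr1.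
Qed.

(* The joint law of two independent variables with laws P and Q. *)
Definition indep_prod (A B : finType) (P : fdist R A) (Q : fdist R B) :
    fdist R (A * B)%type :=
  FDist (fprod_ge0 P Q) (fprod_sum1 P Q).

End Constructions.

Definition stat_dist (R : realType) (A : finType) (P Q : fdist R A) : R :=
  2^-1 * \sum_a `|P a - Q a|.

(* {0,1}^J *)
Definition cube (J : finType) : finType := {ffun J -> bool}.

Definition bitxor (J : finType) (x y : cube J) : cube J :=
  [ffun j => x j (+) y j].

Definition bitand (J : finType) (x y : cube J) : cube J :=
  [ffun j => x j && y j].

(* x_S, as an element of {0,1}^S *)
Definition restr (J : finType) (S : {set J}) (x : cube J) :
    cube {j : J | j \in S} :=
  [ffun j => x (val j)].

Lemma unif_ge0 (R : realType) (J : finType) (x : cube J) :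
  0 <= (#|cube J|%:R)^-1 :> R.
Proof. by rewrite invr_ge0 ler0n. Qed.

Lemma unif_sum1 (R : realType) (J : finType) :
  \sum_(x : cube J) (#|cube J|%:R)^-1 = 1 :> R.
Proof.
rewrite sumr_const -[X in X *+ _]mul1r -mulrnAr -mulr_natl mul1r mulfV //.
by rewrite pnatr_eq0 -lt0n; apply/card_gt0P; exists [ffun => false].
Qed.

Definition unif (R : realType) (J : finType) : fdist R (cube J) :=
  FDist (@unif_ge0 R J) (unif_sum1 R J).

Definition almost_wise_indep (R : realType) (n d : nat) (delta : R)
    (D : fdist R (cube 'I_n)) : Prop :=
  forall S : {set 'I_n}, (#|S| <= d)%N ->
    stat_dist (fmap (restr S) D) (unif R {j : 'I_n | j \in S}) <= delta.

Definition product_test (R : realType) (n k m : nat) (f : cube 'I_n -> R) : Prop :=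
  exists (I : 'I_k -> {set 'I_n})
         (g : forall i : 'I_k, cube {j : 'I_n | j \in I i} -> R),
    [/\ forall i j : 'I_k, i != j -> [disjoint I i & I j],
        forall i : 'I_k, (#|I i| <= m)%N,
        forall (i : 'I_k) (y : cube {j : 'I_n | j \in I i}), -1 <= g i y <= 1
      & forall x : cube 'I_n, f x = \prod_(i < k) g i (restr (I i) x)].

(* Main.v *)
(* Truncate the Fourier expansion of f = f_1 ... f_k at degree a = (d - m)/2 + 1,
   multiplying in one block at a time from the left: f is the sum of a part L of
   degree less than a and of terms H_i F_i, where H_i collects the coefficients
   whose degree reaches a at block i and F_i is the product of the blocks after
   i.  Truncating each F_i in the same way from the right leaves terms of degree
   at most d, which D fools up to their Fourier 1-norm, and terms H_i M H'_j with
   |M| <= 1.  Conditionally on D and T the three factors of the latter are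
   independent, so Cauchy-Schwarz bounds them by the second moments of
   E_U[H_i] and E_U[H'_j].  As H_i^2 involves at most 2(a - 1) + m <= d
   coordinates, such a moment is at most 2^(-a) |H_i|_2^2 plus an error in delta,
   and the sum of the |H_i|_2^2 is at most 1 by Parseval.
   The two-sided truncation yields the factor 2^(-a) although D is only (almost)
   d-wise independent, and it needs Fourier 1-norms up to degree about d/2 only.
   For these the elementary bound (2m)^l at degree l suffices, which follows from
   |c_i(S)| <= 1 - |c_i(empty)| for the coefficients of a block. *)
Require Import Defs.
From mathcomp Require Import all_boot all_order all_algebra.
From mathcomp Require Import all_classical all_reals all_analysis.
From mathcomp Require Import ring lra zify.

Import Order.TTheory GRing.Theory Num.Theory.

Local Open Scope ring_scope.

(** * Expectations *)

Section Expectation.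
Context {R : realType} {A : finType}.
Implicit Types (P : fdist R A) (g h : A -> R).

Lemma eq_expect P g h : g =1 h -> expect P g = expect P h.
Proof. by move=> gh; apply: eq_bigr => a _; rewrite gh. Qed.

Lemma expectD P g h : expect P (fun a => g a + h a) = expect P g + expect P h.
Proof. by rewrite -big_split; apply: eq_bigr => a _; rewrite mulrDr. Qed.

Lemma expect_sum P (I : Type) (r : seq I) (Q : pred I) (F : I -> A -> R) :
  expect P (fun a => \sum_(i <- r | Q i) F i a) =
  \sum_(i <- r | Q i) expect P (F i).
Proof.
by rewrite exchange_big; apply: eq_bigr => a _; rewrite mulr_sumr.
Qed.

Lemma expectZl P (c : R) g : expect P (fun a => c * g a) = c * expect P g.
Proof. by rewrite mulr_sumr; apply: eq_bigr => a _; rewrite mulrCA. Qed.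

Lemma expectZr P (c : R) g : expect P (fun a => g a * c) = expect P g * c.
Proof. by rewrite mulr_suml; apply: eq_bigr => a _; rewrite mulrA. Qed.

Lemma expect_cst P (c : R) : expect P (fun=> c) = c.
Proof. by rewrite /expect -mulr_suml pmf_sum1 mul1r. Qed.

Lemma le_expect P g h : (forall a, g a <= h a) -> expect P g <= expect P h.
Proof. by move=> gh; apply: ler_sum => a _; rewrite ler_wpM2l ?Defs.pmf_ge0. Qed.

Lemma ler_norm_expect P g : `|expect P g| <= expect P (fun a => `|g a|).
Proof.
apply: le_trans (ler_norm_sum _ _ _) _; apply: ler_sum => a _.
by rewrite normrM ger0_norm ?Defs.pmf_ge0.
Qed.

Lemma norm_expect_le P g (c : R) :
  (forall a, `|g a| <= c) -> `|expect P g| <= c.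
Proof.
move=> gc; apply: le_trans (ler_norm_expect P g) _.
by rewrite -[leRHS](expect_cst P); apply: le_expect.
Qed.

End Expectation.

Lemma expect_indep_prod (R : realType) (A B : finType)
    (P : fdist R A) (Q : fdist R B) (g : A * B -> R) :
  expect (indep_prod P Q) g = expect P (fun a => expect Q (fun b => g (a, b))).
Proof.
transitivity (\sum_a \sum_b P a * Q b * g (a, b)).
  by rewrite pair_bigA; apply: eq_bigr => -[a b].
by apply: eq_bigr => a _; rewrite mulr_sumr; apply: eq_bigr => b _; rewrite mulrA.
Qed.

Lemma expect_fmap (R : realType) (A B : finType) (h : A -> B) (P : fdist R A)
    (g : B -> R) :
  expect (Defs.fmap h P) g = expect P (g \o h).
Proof.
rewrite /expect (partition_big h predT) //=; apply: eq_bigr => b _.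
by rewrite mulr_suml; apply: eq_bigr => a /eqP ->.
Qed.

Lemma expect_stat_dist {R : realType} (A : finType) (P Q : fdist R A) (g : A -> R) :
  (forall a, `|g a| <= 1) -> `|expect P g - expect Q g| <= 2 * stat_dist P Q.
Proof.
move=> g1; rewrite /stat_dist mulrA divff ?pnatr_eq0 // mul1r -sumrB.
apply: le_trans (ler_norm_sum _ _ _) _; apply: ler_sum => a _.
by rewrite -mulrBl normrM ler_piMr.
Qed.

(** Lagrange's identity: twice the difference of the two sides is the nonnegative double sum of
    [w a * w b * (g a * h b - g b * h a) ^+ 2]. *)
Lemma cauchy_schwarz_sum (R : realDomainType) (A : finType) (w g h : A -> R) :
  (forall a, 0 <= w a) ->
  (\sum_a w a * (g a * h a)) ^+ 2 <=
  (\sum_a w a * g a ^+ 2) * (\sum_a w a * h a ^+ 2).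
Proof.
move=> w0.
have dbl (u v : A -> R) : (\sum_a u a) * (\sum_b v b) = \sum_a \sum_b u a * v b.
  by rewrite mulr_suml; apply: eq_bigr => a _; rewrite mulr_sumr.
have : 0 <= \sum_a \sum_b w a * w b * (g a * h b - g b * h a) ^+ 2.
  do 2![apply: sumr_ge0 => ? _]; apply: mulr_ge0; last exact: sqr_ge0.
  exact: mulr_ge0.
have -> : \sum_a \sum_b w a * w b * (g a * h b - g b * h a) ^+ 2 =
    (\sum_a w a * g a ^+ 2) * (\sum_a w a * h a ^+ 2)
    + (\sum_a w a * h a ^+ 2) * (\sum_a w a * g a ^+ 2)
    - (\sum_a w a * (g a * h a)) ^+ 2 *+ 2.
  rewrite expr2 !dbl -sumrMnl -big_split -sumrB; apply: eq_bigr => a _.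
  rewrite -sumrMnl -big_split -sumrB; apply: eq_bigr => b _ /=; ring.
by rewrite [X in _ + X - _]mulrC -mulr2n -mulrnBl pmulrn_lge0 // subr_ge0.
Qed.

Lemma cauchy_schwarz_expect {R : realType} {A : finType} (P : fdist R A) (g h : A -> R) :
  expect P (fun a => g a * h a) <=
  Num.sqrt (expect P (fun a => g a ^+ 2)) *
  Num.sqrt (expect P (fun a => h a ^+ 2)).
Proof.
apply: le_trans (ler_norm _) _.
rewrite -sqrtr_sqr -sqrtrM; last first.
  by apply: sumr_ge0 => a _; rewrite mulr_ge0 ?Defs.pmf_ge0 ?sqr_ge0.
by rewrite ler_wsqrtr // cauchy_schwarz_sum // => a; exact: Defs.pmf_ge0.
Qed.

Lemma sqr_sum_le_card {R : realDomainType} {A : finType} (Q : {pred A}) (g : A -> R) :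
  (\sum_(a in Q) g a) ^+ 2 <= #|Q|%:R * \sum_(a in Q) g a ^+ 2.
Proof.
have := @cauchy_schwarz_sum _ A (fun a => (a \in Q)%:R) (fun=> 1) g _.
rewrite (_ : \sum_a (a \in Q)%:R * (1 * g a) = \sum_(a in Q) g a); last first.
  by rewrite [RHS]big_mkcond; apply: eq_bigr => a _; case: ifP; rewrite ?mul1r ?mul0r.
rewrite (_ : \sum_a (a \in Q)%:R * g a ^+ 2 = \sum_(a in Q) g a ^+ 2); last first.
  by rewrite [RHS]big_mkcond; apply: eq_bigr => a _; case: ifP; rewrite ?mul1r ?mul0r.
rewrite (_ : \sum_a (a \in Q)%:R * 1 ^+ 2 = #|Q|%:R); last first.
  rewrite -sum1_card natr_sum [RHS]big_mkcond.
  by apply: eq_bigr => a _; case: ifP; rewrite expr1n mulr1.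
by apply => a; rewrite ler0n.
Qed.

(** * Uniform and almost independent distributions on the cube *)

Section Cube.
Context {R : realType} {n : nat}.
Local Notation cu := (cube 'I_n).
Implicit Types (S A B : {set 'I_n}) (x y t u : cu) (g h : cu -> R).

Local Notation Eu := (expect (unif R 'I_n)).

Lemma bitxorK y : involutive (fun x => bitxor x y).
Proof. by move=> x; apply/ffunP => j; rewrite !ffunE addbK. Qed.

Lemma card_cube (J : finType) : #|cube J| = (2 ^ #|J|)%N.
Proof. by rewrite card_ffun card_bool. Qed.

Lemma unif_shift y g : Eu (fun x => g (bitxor x y)) = Eu g.
Proof.
rewrite /expect [RHS](reindex_inj (inv_inj (bitxorK y))).
by apply: eq_bigr.
Qed.

Definition depends_on A g :=
  forall x y, (forall j, j \in A -> x j = y j) -> g x = g y.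

Lemma depends_onW A B g : A \subset B -> depends_on A g -> depends_on B g.
Proof.
by move=> /fintype.subsetP AB gA x y xy; apply: gA => j /AB; exact: xy.
Qed.

Lemma depends_onM A g h : depends_on A g -> depends_on A h ->
  depends_on A (fun x => g x * h x).
Proof. by move=> gA hA x y xy; rewrite (gA _ _ xy) (hA _ _ xy). Qed.

(* Exchanging the A-coordinates of two independent uniform points preserves
   their joint law. *)
Lemma unif_indep A g h : depends_on A g -> depends_on (~: A) h ->
  Eu (fun x => g x * h x) = Eu g * Eu h.
Proof.
move=> gA hA.
pose mix x y : cu := [ffun j => if j \in A then x j else y j].
pose sw (p : cu * cu) := (mix p.1 p.2, mix p.2 p.1).
have swK : involutive sw.
  by move=> [x y]; congr pair; apply/ffunP => j; rewrite !ffunE /=; case: (j \in A).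
transitivity (expect (indep_prod (unif R 'I_n) (unif R 'I_n))
                (fun p => g p.1 * h p.2)); last first.
  by rewrite expect_indep_prod -expectZr; apply: eq_expect => x /=; rewrite expectZl.
transitivity (expect (indep_prod (unif R 'I_n) (unif R 'I_n))
                (fun p => g p.1 * h p.1)).
  by rewrite expect_indep_prod; apply: eq_expect => x /=; rewrite expect_cst.
rewrite /expect (reindex_inj (inv_inj swK)); apply: eq_bigr => -[x y] _ /=.
congr (_ * (_ * _)).
  by apply: gA => j jA; rewrite ffunE jA.
by apply: hA => j; rewrite inE => /negbTE jA; rewrite ffunE jA.
Qed.

(** A shift by [ext z] xor [ext y] carries one fibre of [restr A] onto another, so all fibres have
    the same mass, and the total mass fixes its value. *)
Lemma fmap_restr_unif A (y : cube {j : 'I_n | j \in A}) :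
  Defs.fmap (restr A) (unif R 'I_n) y = unif R {j : 'I_n | j \in A} y.
Proof.
pose ext (z : cube {j : 'I_n | j \in A}) : cu :=
  [ffun j => oapp z false (insub j)].
have cst z : Defs.fmap (restr A) (unif R 'I_n) z = Defs.fmap (restr A) (unif R 'I_n) y.
  rewrite /= (reindex_inj (inv_inj (bitxorK (bitxor (ext z) (ext y))))) /=.
  apply: eq_bigl => x.
  have -> : restr A (bitxor x (bitxor (ext z) (ext y))) =
            bitxor (restr A x) (bitxor z y).
    by apply/ffunP => j; rewrite !ffunE !valK.
  apply/eqP/eqP => [H|->].
    have -> : restr A x = bitxor (bitxor (restr A x) (bitxor z y)) (bitxor z y).
      by apply/ffunP => j; rewrite !ffunE addbK.
    by rewrite H; apply/ffunP => j; rewrite !ffunE addbA addbb.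
  by apply/ffunP => j; rewrite !ffunE addbCA addbb addbF.
have := pmf_sum1 (Defs.fmap (restr A) (unif R 'I_n)).
rewrite (eq_bigr _ (fun z _ => cst z)) sumr_const -mulr_natr => /eqP.
have N0 : #|cube {j : 'I_n | j \in A}|%:R != 0 :> R.
  by rewrite card_cube pnatr_eq0 expn_eq0.
by move=> /eqP /(canRL (mulfK N0)) ->; rewrite mul1r.
Qed.

(** Extension by zeros makes [g] factor through [restr A], so only the marginals on [A] matter. The
    factor 2 undoes the half in [stat_dist]. *)
Lemma almost_wise_indep_expect (d : nat) (delta : R) (D : fdist R cu) A g :
  almost_wise_indep d delta D -> (#|A| <= d)%N -> depends_on A g ->
  (forall x, `|g x| <= 1) -> `|expect D g - Eu g| <= 2 * delta.
Proof.
move=> Dd Ad gA g1.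
pose ext (z : cube {j : 'I_n | j \in A}) : cu :=
  [ffun j => oapp z false (insub j)].
have gE P : expect P g = expect (Defs.fmap (restr A) P) (g \o ext).
  rewrite expect_fmap; apply: eq_expect => x; apply: gA => j jA.
  by rewrite ffunE insubT /= ffunE.
rewrite !gE.
have -> : expect (Defs.fmap (restr A) (unif R 'I_n)) (g \o ext) =
          expect (unif R {j : 'I_n | j \in A}) (g \o ext).
  by apply: eq_bigr => y _; rewrite fmap_restr_unif.
apply: le_trans (expect_stat_dist _ _ _ _ _) _; first by move=> ?; exact: g1.
by rewrite ler_wpM2l //; exact: Dd.
Qed.

End Cube.

(** * Fourier analysis on the cube *)

Section Characters.
Context {R : realType} {n : nat}.
Local Notation cu := (cube 'I_n).
Implicit Types (S A B : {set 'I_n}) (x y t u : cu) (g h : cu -> R).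

Local Notation Eu := (expect (unif R 'I_n)).

Definition chi S x : R := \prod_(j in S) (-1) ^+ x j.

Lemma chi_set0 x : chi finset.set0 x = 1.
Proof. by rewrite /chi big_set0. Qed.

Lemma chi_bitxor S x y : chi S (bitxor x y) = chi S x * chi S y.
Proof.
by rewrite /chi -big_split; apply: eq_bigr => j _; rewrite ffunE signr_addb.
Qed.

Lemma normr_chi S x : `|chi S x| = 1.
Proof. by rewrite normr_prod big1 // => j _; rewrite normrX normrN1 expr1n. Qed.

Lemma chiK S x : chi S x * chi S x = 1.
Proof. by rewrite -expr2 -real_normK ?num_real // normr_chi expr1n. Qed.

Lemma chi_bitand S t u : chi S (bitand t u) = chi [set j in S | t j] u.
Proof.
rewrite /chi big_mkcond [RHS]big_mkcond; apply: eq_bigr => j _.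
by rewrite inE ffunE; case: (j \in S); case: (t j).
Qed.

Lemma chi_setID B S x : chi S x = chi (S :&: B) x * chi (S :\: B) x.
Proof. by rewrite /chi (big_setID B). Qed.

Lemma depends_on_chi S : depends_on S (chi S).
Proof. by move=> x y xy; apply: eq_bigr => j jS; rewrite xy. Qed.

Definition indicator (j : 'I_n) : cu := [ffun i => i == j].

Lemma chi_indicator S j : chi S (indicator j) = (-1) ^+ (j \in S).
Proof.
rewrite /chi (eq_bigr (fun i => if i == j then -1 else 1)); last first.
  by move=> i _; rewrite ffunE; case: eqP.
rewrite -big_mkcondr /=; case: (boolP (j \in S)) => jS.
  rewrite (big_pred1 j) // => i; rewrite /= andbC.
  by case: eqP => // ->; rewrite jS.
rewrite big_pred0 // => i.
by case: eqP => [->|_]; rewrite ?andbF // (negbTE jS).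
Qed.

(** If [j] lies in exactly one of the two sets, flipping bit [j] negates the product, so its mean
    equals its own opposite. *)
Lemma unif_chiM S S' : Eu (fun x => chi S x * chi S' x) = (S == S')%:R.
Proof.
have [->|neqS] := eqVneq S S'.
  by rewrite -[RHS](expect_cst (unif R 'I_n)); apply: eq_expect => x; exact: chiK.
have [j jSS'] : exists j, (j \in S) != (j \in S').
  apply/existsP; apply: contraNT neqS; rewrite negb_exists => /forallP eqS.
  by apply/eqP/finset.setP => j; apply/eqP; rewrite -[_ == _]negbK.
apply/eqP; rewrite -eqNr -[eqbRHS](unif_shift (indicator j)) -mulN1r -expectZl; apply/eqP.
apply: eq_expect => x; rewrite !chi_bitxor !chi_indicator.
by move: jSS'; case: (j \in S); case: (j \in S') => // _; rewrite ?expr0 ?expr1; ring.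
Qed.

Lemma unif_chi S : Eu (chi S) = (S == finset.set0)%:R.
Proof.
by rewrite -unif_chiM; apply: eq_expect => x; rewrite chi_set0 mulr1.
Qed.

(** The sum over [S] factors over coordinates into terms [1 + (-1) ^+ (x j (+) y j)], one of which
    vanishes as soon as [x] and [y] differ. *)
Lemma sum_chiM x y : \sum_S chi S x * chi S y = #|cu|%:R * (x == y)%:R.
Proof.
transitivity (\sum_(S : {set 'I_n})
    \prod_j (if j \in S then (-1) ^+ (x j (+) y j) else 1 : R)).
  apply: eq_bigr => S _; rewrite -chi_bitxor /chi big_mkcond.
  by apply: eq_bigr => j _; rewrite ffunE.
rewrite -bigA_distr; have [->|neqxy] := eqVneq x y.
  rewrite mulr1 card_cube card_ord natrX -[in RHS](card_ord n) -prodr_const.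
  by apply: eq_bigr => j _; rewrite addbb expr0.
have [j xyj] : exists j, x j != y j.
  apply/existsP; apply: contraNT neqxy; rewrite negb_exists => /forallP eqx.
  by apply/eqP/ffunP => j; apply/eqP; rewrite -[_ == _]negbK.
rewrite mulr0 (bigD1 j) //= (_ : x j (+) y j = true) ?addNr ?mul0r //.
by move: xyj; case: (x j); case: (y j).
Qed.

Definition fcoef g S : R := Eu (fun x => g x * chi S x).

Lemma fourier_inversion g x : g x = \sum_S fcoef g S * chi S x.
Proof.
have N0 : #|cu|%:R != 0 :> R by rewrite card_cube pnatr_eq0 expn_eq0.
transitivity (Eu (fun y => \sum_S g y * (chi S y * chi S x))); last first.
  rewrite expect_sum; apply: eq_bigr => S _; rewrite -expectZr.
  by apply: eq_expect => y; rewrite mulrA.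
rewrite /expect (bigD1 x) //= [X in _ + X]big1 ?addr0 => [|y yx].
  by rewrite -mulr_sumr sum_chiM eqxx mulr1 mulrCA mulVf ?mulr1.
by rewrite -mulr_sumr sum_chiM (negbTE yx) !mulr0.
Qed.

Lemma parseval g : \sum_S fcoef g S ^+ 2 = Eu (fun x => g x ^+ 2).
Proof.
transitivity (Eu (fun x => g x * \sum_S fcoef g S * chi S x)); last first.
  by apply: eq_expect => x; rewrite -fourier_inversion.
transitivity (Eu (fun x => \sum_S g x * (fcoef g S * chi S x))); last first.
  by apply: eq_expect => x; rewrite mulr_sumr.
rewrite expect_sum; apply: eq_bigr => S _; rewrite expr2 {2}/fcoef -expectZl.
by apply: eq_expect => x; rewrite mulrCA.
Qed.

(** Flipping a bit in [S] outside [A] preserves [g] and negates the character, so the coefficient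
    equals its own opposite. *)
Lemma fcoef_eq0 A g S : depends_on A g -> ~~ (S \subset A) -> fcoef g S = 0.
Proof.
move=> gA /subsetPn[j jS jA]; apply/eqP.
rewrite -eqNr /fcoef -[eqbRHS](unif_shift (indicator j)) -mulN1r -expectZl; apply/eqP.
apply: eq_expect => x; rewrite !chi_bitxor !chi_indicator jS expr1.
rewrite (gA (bitxor x _) x) => [|i iA]; first by ring.
by rewrite !ffunE (_ : (i == j) = false) ?addbF //; apply: contraNF jA => /eqP <-.
Qed.

End Characters.

(** * Random restrictions *)

Section RandomRestriction.
Context {R : realType} {n : nat}.
Local Notation cu := (cube 'I_n).
Implicit Types (S A B : {set 'I_n}) (x y t u : cu) (g h : cu -> R).

Local Notation Eu := (expect (unif R 'I_n)).

(** The conditional expectation of [g] at D + T AND U, given D = [x] and T = [t]. *)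
Definition expect_restr x t g : R := Eu (fun u => g (bitxor x (bitand t u))).

Lemma expect_restr_indep x t A g h : depends_on A g -> depends_on (~: A) h ->
  expect_restr x t (fun z => g z * h z) = expect_restr x t g * expect_restr x t h.
Proof.
move=> gA hA; apply: (unif_indep A) => u v uv.
  by apply: gA => j jA; rewrite !ffunE uv.
by apply: hA => j jA; rewrite !ffunE uv.
Qed.

(** Indicates that the character of [S] survives the averaging over U, which happens when [t]
    selects no coordinate of [S]. *)
Definition alive S t : R := ([set j in S | t j] == finset.set0)%:R.

Lemma expect_restr_chi x t S : expect_restr x t (chi S) = chi S x * alive S t.
Proof.
rewrite /alive -unif_chi -expectZl; apply: eq_expect => u.
by rewrite chi_bitxor chi_bitand.
Qed.

Lemma alive_ge0 S t : 0 <= alive S t.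
Proof. exact: ler0n. Qed.

Lemma alive_le1 S t : alive S t <= 1.
Proof. by rewrite lern1 leq_b1. Qed.

Lemma depends_on_alive S : depends_on S (alive S).
Proof.
move=> x y xy; rewrite /alive; congr ((_ == _)%:R).
by apply/finset.setP => j; rewrite !inE; case: (boolP (j \in S)) => //= /xy ->.
Qed.

Lemma alive_prod S t : alive S t = \prod_(j in S) (~~ t j)%:R.
Proof.
rewrite /alive; have [S0|/set0Pn[j]] := eqVneq.
  rewrite big1 // => j jS; case: (boolP (t j)) => // tj.
  by move/finset.setP/(_ j): S0; rewrite !inE jS tj.
by rewrite inE => /andP[jS tj]; rewrite (bigD1 j) //= tj mul0r.
Qed.

Lemma unif_alive S : Eu (alive S) = 2^-1 ^+ #|S|.
Proof.
rewrite /expect /= -mulr_sumr.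
have -> : \sum_(t : cu) alive S t =
    \prod_(j < n) \sum_b (if j \in S then (~~ b)%:R else 1).
  rewrite bigA_distr_bigA /=; apply: eq_bigr => t _.
  by rewrite alive_prod big_mkcond.
rewrite (card_cube 'I_n) card_ord natrX.
have -> : 2 ^+ n = \prod_(j < n) 2 :> R by rewrite prodr_const card_ord.
rewrite -prodfV -big_split -prodr_const [RHS]big_mkcond.
apply: eq_bigr => j _; rewrite big_bool /=; case: ifP => _; first by rewrite add0r mulr1.
by rewrite mulVf // pnatr_eq0.
Qed.

Definition spec_eval (c : {set 'I_n} -> R) x : R := \sum_S c S * chi S x.

Implicit Types c : {set 'I_n} -> R.

Definition spec_supp A c := forall S, ~~ (S \subset A) -> c S = 0.

Lemma depends_on_spec_eval A c : spec_supp A c -> depends_on A (spec_eval c).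
Proof.
move=> cA x y xy; apply: eq_bigr => S _.
have [SA|/cA ->] := boolP (S \subset A); last by rewrite !mul0r.
by rewrite (depends_onW S A _ SA (depends_on_chi S) x y xy).
Qed.

Lemma unif_spec_eval c : Eu (spec_eval c) = c finset.set0.
Proof.
rewrite expect_sum (bigD1 finset.set0) //= big1 ?addr0 => [|S S0].
  by rewrite expectZl unif_chi eqxx mulr1.
by rewrite expectZl unif_chi (negbTE S0) mulr0.
Qed.

Section AlmostIndependent.
Context (d : nat) (delta : R) (D T : fdist R cu).
Hypothesis Dd : almost_wise_indep d delta D.
Hypothesis Td : almost_wise_indep d delta T.

Lemma delta_ge0 : 0 <= delta.
Proof.
apply: le_trans (Dd finset.set0 _); last by rewrite cards0.
by rewrite mulr_ge0 ?invr_ge0 ?sumr_ge0.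
Qed.

Lemma almost_chiM S S' : (#|S :|: S'| <= d)%N ->
  `|expect D (fun x => chi S x * chi S' x) - (S == S')%:R| <= 2 * delta.
Proof.
move=> SS'; rewrite -unif_chiM.
apply: (almost_wise_indep_expect _ _ _ _ _ Dd SS') => [|x].
  by apply: depends_onM; apply: depends_onW (depends_on_chi _);
    [exact: finset.subsetUl|exact: finset.subsetUr].
by rewrite normrM !normr_chi mulr1.
Qed.

Lemma almost_alive S : (#|S| <= d)%N ->
  expect T (alive S) <= 2^-1 ^+ #|S| + 2 * delta.
Proof.
move=> Sd; rewrite -unif_alive addrC -lerBlDr; apply: le_trans (ler_norm _) _.
apply: (almost_wise_indep_expect _ _ _ _ _ Td Sd); first exact: depends_on_alive.
by move=> t; rewrite ger0_norm ?alive_ge0 ?alive_le1.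
Qed.

(** Expand the square into pairs of characters. On the diagonal the D-factor is 1 and T makes [S]
    survive with probability at most [2^-1 ^+ a + 2 * delta]; off the diagonal the D-factor is at
    most [2 * delta] in absolute value. *)
Lemma expect_restr_sqr_le (a : nat) c :
  (forall S, c S != 0 -> (a <= #|S|)%N) ->
  (forall S S', c S != 0 -> c S' != 0 -> (#|S :|: S'| <= d)%N) ->
  expect D (fun x => expect T (fun t => expect_restr x t (spec_eval c) ^+ 2)) <=
  2^-1 ^+ a * (\sum_S c S ^+ 2) + 2 * delta * (\sum_S `|c S|) ^+ 2.
Proof.
move=> ca cd.
have sqrE x t : expect_restr x t (spec_eval c) ^+ 2 = \sum_S \sum_S'
    c S * c S' * (chi S x * chi S' x * (alive S t * alive S' t)).
  rewrite /expect_restr expect_sum expr2 mulr_suml; apply: eq_bigr => S _.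
  rewrite mulr_sumr; apply: eq_bigr => S' _.
  have E W : Eu (fun u => c W * chi W (bitxor x (bitand t u))) =
             c W * (chi W x * alive W t).
    by rewrite expectZl -expect_restr_chi.
  by rewrite !E; ring.
have -> : expect D (fun x => expect T (fun t => expect_restr x t (spec_eval c) ^+ 2))
   = \sum_S \sum_S' c S * c S' * (expect D (fun x => chi S x * chi S' x) *
       expect T (fun t => alive S t * alive S' t)).
  under eq_expect => x do under eq_expect => t do rewrite sqrE.
  under eq_expect => x do rewrite expect_sum.
  rewrite expect_sum; apply: eq_bigr => S _.
  under eq_expect => x do rewrite expect_sum.
  rewrite expect_sum; apply: eq_bigr => S' _.
  under eq_expect => x do rewrite expectZl expectZl.
  by rewrite expectZl expectZr.
have -> : 2^-1 ^+ a * (\sum_S c S ^+ 2) + 2 * delta * (\sum_S `|c S|) ^+ 2 =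
    \sum_S \sum_S' (2^-1 ^+ a * (c S * c S' * (S == S')%:R)
                    + 2 * delta * (`|c S| * `|c S'|)).
  rewrite expr2 mulr_suml !mulr_sumr -big_split; apply: eq_bigr => S _.
  rewrite big_split !mulr_sumr; congr (_ + _).
  rewrite (bigD1 S) //= eqxx big1 ?addr0 ?mulr1 ?expr2 // => S' S'S.
  by rewrite eq_sym (negbTE S'S) !mulr0.
apply: ler_sum => S _; apply: ler_sum => S' _.
have d0 := delta_ge0.
have [->|cS] := eqVneq (c S) 0; first by rewrite !(mul0r, mulr0, normr0, addr0).
have [->|cS'] := eqVneq (c S') 0; first by rewrite !(mul0r, mulr0, normr0, addr0).
have := almost_chiM S S' (cd _ _ cS cS').
have [<-|neqS] := eqVneq S S'.
  move=> _; have -> : expect D (fun x => chi S x * chi S x) = 1.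
    by rewrite -[RHS](expect_cst D); apply: eq_expect => x; exact: chiK.
  have -> : expect T (fun t => alive S t * alive S t) = expect T (alive S).
    by apply: eq_expect => t; rewrite /alive; case: eqP; rewrite ?mulr0 ?mulr1.
  rewrite -normrM ger0_norm -expr2 ?sqr_ge0 // mulr1 mul1r.
  rewrite [2^-1 ^+ a * _]mulrC [2 * _ * _]mulrC -mulrDr ler_wpM2l ?sqr_ge0 //.
  apply: le_trans (almost_alive S _) _; first by rewrite -[S]finset.setUid cd.
  by rewrite lerD2r ler_wiXn2l ?ca ?invr_ge0 ?invf_le1 ?ler1n.
rewrite subr0 !mulr0 add0r => chi_le; apply: le_trans (ler_norm _) _.
rewrite !normrM mulrC ler_wpM2r ?mulr_ge0 //.
rewrite -[leRHS]mulr1 ler_pM //.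
by apply: norm_expect_le => t; rewrite normrM !ger0_norm ?alive_ge0 // mulr_ile1
  ?alive_ge0 ?alive_le1.
Qed.

Definition expect_xor_and g : R :=
  expect D (fun x => expect T (fun t => expect_restr x t g)).

Definition fooling_error g : R := expect_xor_and g - Eu g.

Lemma eq_fooling_error g h : g =1 h -> fooling_error g = fooling_error h.
Proof.
move=> gh; congr (_ - _); last exact: eq_expect.
by apply: eq_expect => x; apply: eq_expect => t; apply: eq_expect => u.
Qed.

Lemma fooling_errorD g h :
  fooling_error (fun x => g x + h x) = fooling_error g + fooling_error h.
Proof.
rewrite /fooling_error expectD opprD addrACA; congr (_ + _).
rewrite -expectD; apply: eq_expect => x; rewrite -expectD; apply: eq_expect => t.
exact: expectD.
Qed.

Lemma fooling_error_sum (J : Type) (r : seq J) (Q : pred J) (F : J -> cu -> R) :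
  fooling_error (fun x => \sum_(i <- r | Q i) F i x) =
  \sum_(i <- r | Q i) fooling_error (F i).
Proof.
rewrite /fooling_error expect_sum sumrB; congr (_ - _).
rewrite -expect_sum; apply: eq_expect => x; rewrite -expect_sum.
by apply: eq_expect => t; exact: expect_sum.
Qed.

Lemma fooling_errorZl (c : R) g :
  fooling_error (fun x => c * g x) = c * fooling_error g.
Proof.
rewrite /fooling_error expectZl mulrBr; congr (_ - _).
rewrite -expectZl; apply: eq_expect => x; rewrite -expectZl.
by apply: eq_expect => t; exact: expectZl.
Qed.

(** For equal sets the product is the constant 1 and has no error. For distinct sets the expectation
    splits into a D-factor, which is small, and a factor in T and U of absolute value at most 1. *)
Lemma fooling_error_chiM S S' : (#|S :|: S'| <= d)%N ->
  `|fooling_error (fun x => chi S x * chi S' x)| <= 2 * delta.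
Proof.
move=> SS'; have d0 := delta_ge0.
have [<-|neqS] := eqVneq S S'.
  rewrite (eq_fooling_error _ (fun=> 1)) => [|x]; last exact: chiK.
  rewrite /fooling_error /expect_xor_and /expect_restr !expect_cst subrr normr0.
  by rewrite mulr_ge0.
rewrite /fooling_error unif_chiM (negbTE neqS) subr0.
have -> : expect_xor_and (fun x => chi S x * chi S' x) =
    expect D (fun x => chi S x * chi S' x) *
    expect T (fun t => Eu (fun u => chi S (bitand t u) * chi S' (bitand t u))).
  rewrite -expectZr; apply: eq_expect => x; rewrite -expectZl; apply: eq_expect => t.
  by rewrite -expectZl; apply: eq_expect => u; rewrite !chi_bitxor; ring.
have := almost_chiM S S' SS'; rewrite (negbTE neqS) subr0 => chi_le.
rewrite normrM -[leRHS]mulr1 ler_pM //.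
apply: norm_expect_le => t; apply: norm_expect_le => u.
by rewrite normrM !normr_chi mulr1.
Qed.

Lemma fooling_error_low_degree c c' :
  (forall S S', c S != 0 -> c' S' != 0 -> (#|S :|: S'| <= d)%N) ->
  `|fooling_error (fun x => spec_eval c x * spec_eval c' x)| <=
  2 * delta * ((\sum_S `|c S|) * (\sum_S `|c' S|)).
Proof.
move=> cd.
rewrite (eq_fooling_error _ (fun x => \sum_S \sum_S' c S * c' S' * (chi S x * chi S' x))).
  rewrite fooling_error_sum mulr_suml mulr_sumr; apply: le_trans (ler_norm_sum _ _ _) _.
  apply: ler_sum => S _; rewrite fooling_error_sum !mulr_sumr.
  apply: le_trans (ler_norm_sum _ _ _) _; apply: ler_sum => S' _.
  rewrite fooling_errorZl !normrM [leRHS]mulrC.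
  have [->|cS] := eqVneq (c S) 0; first by rewrite !(mul0r, normr0).
  have [->|cS'] := eqVneq (c' S') 0; first by rewrite !(mul0r, mulr0, normr0).
  by rewrite ler_wpM2l ?mulr_ge0 // fooling_error_chiM ?cd.
move=> x; rewrite mulr_suml; apply: eq_bigr => S _; rewrite mulr_sumr.
by apply: eq_bigr => S' _; ring.
Qed.

(* The middle factor is bounded, and conditionally on x and t the three factors
   are independent, so only the second moments of the outer two matter. *)
Lemma fooling_error_high_degree A B c c' h :
  spec_supp A c -> depends_on B h -> spec_supp (~: (A :|: B)) c' -> [disjoint A & B] ->
  c finset.set0 = 0 -> (forall x, `|h x| <= 1) ->
  `|fooling_error (fun x => spec_eval c x * (h x * spec_eval c' x))| <=
  Num.sqrt (expect D (fun x => expect T (fun t => expect_restr x t (spec_eval c) ^+ 2))) *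
  Num.sqrt (expect D (fun x => expect T (fun t => expect_restr x t (spec_eval c') ^+ 2))).
Proof.
move=> cA hB c'AB disAB c0 h1.
have dA := depends_on_spec_eval A c cA.
have dB : depends_on (~: B) (spec_eval c').
  apply: depends_onW (depends_on_spec_eval _ _ c'AB).
  by rewrite finset.setCS finset.subsetUr.
have dAB : depends_on (~: A) (fun x => h x * spec_eval c' x).
  apply: depends_onM.
    by apply: depends_onW hB; rewrite finset.subsets_disjoint finset.setCK disjoint_sym.
  apply: depends_onW (depends_on_spec_eval _ _ c'AB).
  by rewrite finset.setCS finset.subsetUl.
(* Under U the factor [spec_eval c] is independent of the others and has mean [c finset.set0 = 0],
   so only the pseudorandom expectation remains. *)
rewrite /fooling_error (unif_indep A _ _ dA dAB) unif_spec_eval c0 mul0r subr0.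
have pairE (F : cu -> cu -> R) : expect D (fun x => expect T (fun t => F x t)) =
    expect (indep_prod D T) (fun p => F p.1 p.2) by rewrite expect_indep_prod.
rewrite /expect_xor_and 3!pairE; apply: le_trans (ler_norm_expect _ _) _.
have -> : expect (indep_prod D T) (fun p => expect_restr p.1 p.2 (spec_eval c) ^+ 2) =
    expect (indep_prod D T) (fun p => `|expect_restr p.1 p.2 (spec_eval c)| ^+ 2).
  by apply: eq_expect => p; rewrite real_normK ?num_real.
have -> : expect (indep_prod D T) (fun p => expect_restr p.1 p.2 (spec_eval c') ^+ 2) =
    expect (indep_prod D T) (fun p => `|expect_restr p.1 p.2 (spec_eval c')| ^+ 2).
  by apply: eq_expect => p; rewrite real_normK ?num_real.
apply: le_trans (cauchy_schwarz_expect _ _ _); apply: le_expect => p.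
rewrite (expect_restr_indep _ _ A _ _ dA dAB) (expect_restr_indep _ _ B _ _ hB dB).
rewrite !normrM ler_wpM2l // ler_piMl //.
by apply: norm_expect_le => u; exact: h1.
Qed.

End AlmostIndependent.
End RandomRestriction.

(** * Products of blocks and truncation by degree *)

Section SpectrumProduct.
Context {R : realType} {n : nat}.
Local Notation cu := (cube 'I_n).
Implicit Types (S A B : {set 'I_n}) (x y : cu) (c L : {set 'I_n} -> R).

(** A set [S] corresponds bijectively to the pair of its parts outside and inside [B]. *)
Lemma sum_setD_setI B (F G : {set 'I_n} -> R) :
  \sum_S F (S :\: B) * G (S :&: B) =
  (\sum_(S : {set 'I_n} | S \subset ~: B) F S) * (\sum_(S : {set 'I_n} | S \subset B) G S).
Proof.
rewrite mulr_suml; under [RHS]eq_bigr => S _ do rewrite mulr_sumr.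
rewrite pair_big /=.
rewrite (reindex_onto (fun S => (S :\: B, S :&: B)) (fun p => p.1 :|: p.2)) /=.
  apply: eq_bigl => S; rewrite subsetIr finset.setUC finset.setID eqxx andbT andbT.
  by rewrite finset.setDE subsetIr.
move=> [S1 S2] /= /andP[/fintype.subsetP S1B /fintype.subsetP S2B].
congr pair; apply/finset.setP => j; have := S1B j; have := S2B j; rewrite !inE.
  by case: (j \in S1); case: (j \in S2); case: (j \in B) => //= H1 H2;
    by [have := H1 isT | have := H2 isT].
by case: (j \in S1); case: (j \in S2); case: (j \in B) => //= H1 H2;
    by [have := H1 isT | have := H2 isT].
Qed.

Lemma sum_setD_setI_le B (F G : {set 'I_n} -> R) :
  (forall S, 0 <= F S) -> (forall S, 0 <= G S) ->
  \sum_S F (S :\: B) * G (S :&: B) <= (\sum_S F S) * (\sum_S G S).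
Proof.
move=> F0 G0; rewrite sum_setD_setI ler_pM ?sumr_ge0 //.
  by rewrite [leRHS](bigID (fun S => S \subset ~: B)) /= lerDl sumr_ge0.
by rewrite [leRHS](bigID (fun S => S \subset B)) /= lerDl sumr_ge0.
Qed.

(* The Fourier coefficients of a product of two functions, the second one
   depending on B only and the first one on the complement of B only. *)
Definition spec_mul B L c S : R := L (S :\: B) * c (S :&: B).

Lemma spec_eval_mul B L c x : spec_supp (~: B) L -> spec_supp B c ->
  spec_eval (spec_mul B L c) x = spec_eval L x * spec_eval c x.
Proof.
move=> LB cB; have := sum_setD_setI B (fun S => L S * chi S x) (fun S => c S * chi S x).
under eq_bigr => S _ do rewrite mulrACA [chi _ x * _]mulrC -chi_setID.
move=> E; rewrite [LHS]E /spec_eval [in RHS](bigID (fun S => S \subset ~: B)) /=.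
rewrite [X in (_ + X) * _]big1 ?addr0 => [|S /LB ->]; last by rewrite mul0r.
congr (_ * _); rewrite [RHS](bigID (fun S => S \subset B)) /=.
by rewrite [X in _ + X]big1 ?addr0 // => S /cB ->; rewrite mul0r.
Qed.

Lemma sqr_spec_mul_le B L c :
  \sum_S spec_mul B L c S ^+ 2 <= (\sum_S L S ^+ 2) * (\sum_S c S ^+ 2).
Proof.
under eq_bigr => S _ do rewrite exprMn.
by apply: (sum_setD_setI_le B (fun S => L S ^+ 2) (fun S => c S ^+ 2)) => S;
  exact: sqr_ge0.
Qed.

(** The weight [r ^+ #|S|] is multiplicative over the parts of [S] outside and inside [B], so the
    weighted 1-norm is submultiplicative. *)
Lemma norm_spec_mul_le B L c (r : R) : 0 <= r ->
  \sum_(S : {set 'I_n}) r ^+ #|S| * `|spec_mul B L c S| <=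
  (\sum_(S : {set 'I_n}) r ^+ #|S| * `|L S|) * (\sum_(S : {set 'I_n}) r ^+ #|S| * `|c S|).
Proof.
move=> r0; apply: le_trans (sum_setD_setI_le B (fun S => r ^+ #|S| * `|L S|)
  (fun S => r ^+ #|S| * `|c S|) _ _); last 2 first.
- by move=> S; rewrite mulr_ge0 ?exprn_ge0.
- by move=> S; rewrite mulr_ge0 ?exprn_ge0.
apply: ler_sum => S _; rewrite -(cardsID B S) exprD normrM le_eqVlt.
by apply/orP; left; apply/eqP; ring.
Qed.

Lemma norm1_spec_mul_le B L c :
  \sum_S `|spec_mul B L c S| <= (\sum_S `|L S|) * (\sum_S `|c S|).
Proof.
have E c' : \sum_S `|c' S| = \sum_(S : {set 'I_n}) 1 ^+ #|S| * `|c' S| :> R.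
  by apply: eq_bigr => S _; rewrite expr1n mul1r.
by rewrite !E; exact: norm_spec_mul_le.
Qed.

End SpectrumProduct.

Section Truncation.
Context {R : realType} {n : nat}.
Local Notation cu := (cube 'I_n).
Implicit Types (S A B : {set 'I_n}) (x y : cu).

Variables (I : nat -> {set 'I_n}) (c : nat -> {set 'I_n} -> R) (a : nat).
Hypothesis disI : forall i j, i != j -> [disjoint I i & I j].
Hypothesis suppc : forall i, spec_supp (I i) (c i).

(* Of the product of the first i blocks, [low i] keeps the Fourier coefficients
   of degree less than a; [high i] collects the ones that reach degree a exactly
   when block i is multiplied in. *)
Fixpoint low (i : nat) : {set 'I_n} -> R :=
  if i is j.+1 then
    fun S => if (#|S| < a)%N then spec_mul (I j) (low j) (c j) S else 0
  else fun S => (S == finset.set0)%:R.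

Definition high (i : nat) S : R :=
  if (#|S| < a)%N then 0 else spec_mul (I i) (low i) (c i) S.

Definition first_blocks (i : nat) : {set 'I_n} := \bigcup_(l < i) I l.

Lemma first_blocksS i : first_blocks i.+1 = first_blocks i :|: I i.
Proof. exact: big_ord_recr. Qed.

Lemma disjoint_first_blocks B i : (forall l, (l < i)%N -> [disjoint I l & B]) ->
  [disjoint first_blocks i & B].
Proof.
move=> dis; rewrite -setI_eq0 big_distrl /=; apply/eqP; apply: big1 => l _.
by apply/eqP; rewrite setI_eq0 dis.
Qed.

Lemma first_blocks_sub_setC i : first_blocks i \subset ~: I i.
Proof.
rewrite -finset.disjoints_subset; apply: disjoint_first_blocks => l li.
by apply: disI; rewrite ltn_eqF.
Qed.

Lemma spec_supp_mul B L (c' : {set 'I_n} -> R) A : spec_supp A L -> spec_supp B c' ->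
  spec_supp (A :|: B) (spec_mul B L c').
Proof.
move=> LA cB S; rewrite /spec_mul; have [SA|/LA ->] := boolP (S :\: B \subset A).
  move=> SAB; case/negP: SAB; rewrite -(finset.setID S B) finset.setUC.
  by rewrite finset.setUSS // subsetIr.
by rewrite mul0r.
Qed.

Lemma supp_low i : spec_supp (first_blocks i) (low i).
Proof.
elim: i => [|i IHi] S /=.
  by case: eqP => // ->; rewrite finset.sub0set.
rewrite first_blocksS => SI; case: ifP => // _.
exact: spec_supp_mul IHi (suppc i) S SI.
Qed.

Lemma supp_high i : spec_supp (first_blocks i.+1) (high i).
Proof.
rewrite first_blocksS => S SI; rewrite /high; case: ifP => // _.
exact: spec_supp_mul (supp_low i) (suppc i) S SI.
Qed.

Lemma spec_eval_step i x :
  spec_eval (low i) x * spec_eval (c i) x =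
  spec_eval (low i.+1) x + spec_eval (high i) x.
Proof.
rewrite -(spec_eval_mul (I i)); last exact: suppc; last first.
  move=> S SI; apply: (supp_low i S); apply: contra SI => SI.
  exact: fintype.subset_trans SI (first_blocks_sub_setC i).
rewrite -big_split; apply: eq_bigr => S _; rewrite /= /high -mulrDl.
by case: ifP; rewrite ?addr0 ?add0r.
Qed.

Lemma spec_eval_low0 x : spec_eval (low 0) x = 1.
Proof.
rewrite /spec_eval (bigD1 finset.set0) //= eqxx mul1r chi_set0 big1 ?addr0 // => S S0.
by rewrite (negbTE S0) mul0r.
Qed.

(** By induction on [k]: multiplying [low k] by the next block splits it into [low k.+1] and the new
    [high k], while each earlier [high i] just gains one more factor on its right. *)
Lemma prod_spec_eval k x :
  \prod_(i < k) spec_eval (c i) x = spec_eval (low k) x +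
  \sum_(i < k) spec_eval (high i) x * \prod_(i.+1 <= l < k) spec_eval (c l) x.
Proof.
elim: k => [|k IHk]; first by rewrite !big_ord0 addr0 spec_eval_low0.
rewrite big_ord_recr /= IHk mulrDl spec_eval_step -addrA; congr (_ + _).
rewrite mulr_suml [RHS]big_ord_recr /= big_geq // mulr1 addrC; congr (_ + _).
by apply: eq_bigr => i _; rewrite -mulrA big_nat_recr.
Qed.

Lemma card_low i S : (0 < a)%N -> low i S != 0 -> (#|S| < a)%N.
Proof.
case: i => [|i] a0 /=; last by case: ifP => // _; rewrite eqxx.
by have [->|_] := eqVneq S finset.set0; rewrite ?cards0 ?eqxx.
Qed.

Lemma card_high i S : high i S != 0 -> (a <= #|S|)%N.
Proof. by rewrite /high ltnNge; case: leqP => //=; rewrite eqxx. Qed.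

Lemma high_set0 i : (0 < a)%N -> high i finset.set0 = 0.
Proof. by rewrite /high cards0 => ->. Qed.

Lemma card_highD i S : (0 < a)%N -> high i S != 0 -> (#|S :\: I i| < a)%N.
Proof.
rewrite /high => a0; case: ifP => [_|_ ]; first by rewrite eqxx.
by rewrite mulf_eq0 negb_or => /andP[/(card_low _ _ a0)].
Qed.

(** Outside block [i] each set has at most [a - 1] elements, since the degree was still below [a]
    before that block; inside it both share the same [m] coordinates, counted once. *)
Lemma card_highU m i S S' : (0 < a)%N -> (#|I i| <= m)%N ->
  high i S != 0 -> high i S' != 0 -> (#|S :|: S'| <= a.-1.*2 + m)%N.
Proof.
move=> a0 Im /(card_highD _ _ a0) Sa /(card_highD _ _ a0) S'a.
have : S :|: S' \subset (S :\: I i) :|: (S' :\: I i) :|: I i.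
  by apply/fintype.subsetP => j; rewrite !inE; case: (j \in I i); rewrite ?orbT ?orbF.
move/subset_leq_card => H; apply: leq_trans H _.
have := (leq_card_setU (S :\: I i :|: S' :\: I i) (I i)).1.
have := (leq_card_setU (S :\: I i) (S' :\: I i)).1.
by move: Sa S'a; lia.
Qed.

(** The invariant includes the squared mass of [low k]: multiplying by a block does not increase
    this mass, and the cut at degree [a] merely divides it between [low k.+1] and [high k]. *)
Lemma sqr_high_le k : (forall i, \sum_S c i S ^+ 2 <= 1) ->
  \sum_(i < k) \sum_S high i S ^+ 2 <= 1.
Proof.
move=> c1; suff: \sum_S low k S ^+ 2 + \sum_(i < k) \sum_S high i S ^+ 2 <= 1.
  by apply: le_trans; rewrite lerDr sumr_ge0 // => S _; exact: sqr_ge0.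
elim: k => [|k IHk].
  rewrite big_ord0 addr0 (bigD1 finset.set0) //= eqxx expr1n big1 ?addr0 // => S S0.
  by rewrite (negbTE S0) expr0n.
rewrite big_ord_recr /=; apply: le_trans IHk.
rewrite addrCA addrC lerD2r -big_split /=.
apply: le_trans (_ : \sum_S spec_mul (I k) (low k) (c k) S ^+ 2 <= _).
  by apply: ler_sum => S _; rewrite /high; case: ifP; rewrite expr0n ?addr0 ?add0r.
apply: le_trans (sqr_spec_mul_le _ _ _) _.
by rewrite ler_piMr ?c1 // sumr_ge0 // => S _; exact: sqr_ge0.
Qed.

(** The 1-norm weighted by [r ^+ #|S|] stays at most 1 through all multiplications and truncations.
    Removing the weight costs at most [r^-1 ^+ a.-1], as only degrees below [a] occur. *)
Lemma norm_low_le (r : R) i : 0 < r -> r <= 1 -> (0 < a)%N ->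
  (forall l, \sum_(S : {set 'I_n}) r ^+ #|S| * `|c l S| <= 1) ->
  \sum_S `|low i S| <= r^-1 ^+ a.-1.
Proof.
move=> r0 r1 a0 c1.
have {c1} : \sum_(S : {set 'I_n}) r ^+ #|S| * `|low i S| <= 1.
  elim: i => [|i IHi].
    rewrite (bigD1 finset.set0) //= eqxx cards0 normr1 mulr1 big1 ?addr0 // => S S0.
    by rewrite (negbTE S0) normr0 mulr0.
  apply: le_trans (_ : \sum_(S : {set 'I_n})
      r ^+ #|S| * `|spec_mul (I i) (low i) (c i) S| <= _).
    apply: ler_sum => S _ /=; case: ifP => // _.
    by rewrite normr0 mulr0 mulr_ge0 ?exprn_ge0 // ltW.
  apply: le_trans (norm_spec_mul_le _ _ _ _ (ltW r0)) _.
  by rewrite mulr_ile1 ?c1 // sumr_ge0 // => S _; rewrite mulr_ge0 ?exprn_ge0 // ltW.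
move=> low1; rewrite exprVn -[leRHS]mul1r ler_pdivlMr ?exprn_gt0 //.
apply: le_trans low1; rewrite mulr_suml; apply: ler_sum => S _.
have [->|/(card_low _ _ a0) Sa] := eqVneq (low i S) 0; first by rewrite normr0 mul0r mulr0.
by rewrite mulrC ler_wpM2r // ler_wiXn2l ?(ltW r0) // -ltnS prednK.
Qed.

Lemma norm_high_le i : \sum_S `|high i S| <= (\sum_S `|low i S|) * (\sum_S `|c i S|).
Proof.
apply: le_trans (norm1_spec_mul_le (I i) (low i) (c i)); apply: ler_sum => S _.
by rewrite /high; case: ifP => // _; rewrite normr0.
Qed.

End Truncation.

(** * Fourier norms of a single block *)

Section BlockSpectrum.
Context {R : realType} {n : nat}.
Local Notation cu := (cube 'I_n).
Implicit Types (S A B : {set 'I_n}) (x y : cu) (g : cu -> R).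

Lemma sqr_fcoef_le g : (forall x, `|g x| <= 1) -> \sum_S fcoef g S ^+ 2 <= 1.
Proof.
move=> g1; rewrite parseval -[leRHS](expect_cst (unif R 'I_n)).
by apply: le_expect => x; rewrite -real_normK ?num_real // exprn_ile1.
Qed.

(** Cauchy-Schwarz over the [2 ^+ #|A|] subsets of [A], followed by Parseval. *)
Lemma norm_fcoef_le A g : depends_on A g -> (forall x, `|g x| <= 1) ->
  (\sum_S `|fcoef g S|) ^+ 2 <= 2 ^+ #|A|.
Proof.
move=> gA g1.
rewrite (bigID (fun S => S \in powerset A)) /= [X in _ + X]big1 ?addr0; last first.
  by move=> S; rewrite powersetE => /(fcoef_eq0 _ _ _ gA) ->; rewrite normr0.
apply: le_trans (sqr_sum_le_card _ _) _; rewrite card_powerset natrX.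
rewrite ler_piMr ?exprn_ge0 //; apply: le_trans (sqr_fcoef_le g g1).
under eq_bigr => S _ do rewrite real_normK ?num_real //.
rewrite [leRHS](bigID (fun S => S \in powerset A)) /= lerDl sumr_ge0 // => S _.
exact: sqr_ge0.
Qed.

(* Subtracting from g the nearer of the constants 1 and -1 does not affect the
   nonconstant coefficients. *)
Lemma fcoef_le_mean g S : (forall x, `|g x| <= 1) -> S != finset.set0 ->
  `|fcoef g S| <= 1 - `|fcoef g finset.set0|.
Proof.
move=> g1 S0.
have mean : fcoef g finset.set0 = expect (unif R 'I_n) g.
  by apply: eq_expect => x; rewrite chi_set0 mulr1.
have shift (s : R) : (forall x, 0 <= 1 + s * g x) -> `|s| = 1 ->
    `|fcoef g S| <= 1 + s * fcoef g finset.set0.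
  move=> sg s1; rewrite mean -expectZl -[X in X + _](expect_cst (unif R 'I_n)) -expectD.
  have -> : `|fcoef g S| =
      `|expect (unif R 'I_n) (fun x => (1 + s * g x) * chi S x)|.
    rewrite (eq_expect _ _ (fun x => chi S x + s * (g x * chi S x))); last first.
      by move=> x; ring.
    by rewrite expectD unif_chi (negbTE S0) add0r expectZl normrM s1 mul1r.
  apply: le_trans (ler_norm_expect _ _) _; apply: le_expect => x.
  by rewrite normrM normr_chi mulr1 ger0_norm.
have [m0|m0] := leP 0 (fcoef g finset.set0).
  rewrite (ger0_norm m0) -mulN1r; apply: shift => [x|]; last by rewrite normrN1.
  by rewrite mulN1r subr_ge0; apply: le_trans (ler_norm _) (g1 x).
rewrite (ltr0_norm m0) opprK -[X in 1 + X]mul1r; apply: shift => [x|]; last exact: normr1.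
rewrite mul1r addrC -lerBlDr sub0r; apply: le_trans (_ : - `|g x| <= _).
  by rewrite lerN2.
by rewrite lerNl -normrN ler_norm.
Qed.

Lemma sum_expr_card A (r : R) :
  \sum_(S : {set 'I_n} | S \subset A) r ^+ #|S| = (1 + r) ^+ #|A|.
Proof.
have -> : (1 + r) ^+ #|A| = \prod_j ((if j \in A then r else 0) + 1).
  rewrite -prodr_const [LHS]big_mkcond; apply: eq_bigr => j _.
  by case: ifP => _; rewrite ?add0r // addrC.
rewrite bigA_distr [LHS]big_mkcond; apply: eq_bigr => S _.
case: ifP => [/fintype.subsetP SA|/negbT/subsetPn[j jS jA]].
  rewrite -prodr_const [LHS]big_mkcond; apply: eq_bigr => j _.
  by case: ifP => // /SA ->.
by rewrite (bigD1 j) //= jS (negbTE jA) mul0r.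
Qed.

(** Each nonconstant coefficient is at most [1 - mu], and the nonempty subsets of [A] have total
    weight [(1 + r) ^+ #|A| - 1 <= 1]; hence the sum is at most [mu + (1 - mu)]. *)
Lemma weighted_norm_fcoef_le A g (r : R) : depends_on A g -> (forall x, `|g x| <= 1) ->
  0 <= r -> (1 + r) ^+ #|A| <= 2 -> \sum_(S : {set 'I_n}) r ^+ #|S| * `|fcoef g S| <= 1.
Proof.
move=> gA g1 r0 r2; pose mu := `|fcoef g finset.set0|.
have mu1 : mu <= 1.
  by apply: norm_expect_le => x; rewrite chi_set0 mulr1.
rewrite (bigD1 finset.set0) //= cards0 expr0 mul1r -/mu.
suff : \sum_(S : {set 'I_n} | S != finset.set0) r ^+ #|S| * `|fcoef g S| <= 1 - mu.
  by rewrite lerBrDl.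
apply: le_trans (_ : \sum_(S : {set 'I_n} | (S \subset A) && (S != finset.set0))
    r ^+ #|S| * (1 - mu) <= _).
  rewrite (bigID (fun S => S \subset A)) /= [X in _ + X]big1 ?addr0; last first.
    by move=> S /andP[_ /(fcoef_eq0 _ _ _ gA) ->]; rewrite normr0 mulr0.
  under eq_bigl => S do rewrite andbC.
  apply: ler_sum => S /andP[_ S0]; rewrite ler_wpM2l ?exprn_ge0 //.
  exact: fcoef_le_mean.
rewrite -mulr_suml ler_piMl ?subr_ge0 //.
move: r2; rewrite -sum_expr_card (bigD1 finset.set0) ?finset.sub0set //= cards0 expr0.
by rewrite -[X in _ <= X -> _]/(1 + 1) lerD2l.
Qed.

End BlockSpectrum.

(** * The two-sided truncation *)

Lemma spec_eval_fcoef {R : realType} {n : nat} (g : cube 'I_n -> R) x :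
  spec_eval (fcoef g) x = g x.
Proof. exact/esym/fourier_inversion. Qed.

Lemma exprD1_inv_double_le2 (R : realType) (m j : nat) : (0 < m)%N -> (j <= m)%N ->
  (1 + (2 * m%:R)^-1) ^+ j <= 2 :> R.
Proof.
move=> m0 jm; set r := (2 * m%:R)^-1.
have r0 : 0 <= r by rewrite invr_ge0 mulr_ge0.
have mr : 2 * m%:R * r = 1 by rewrite mulfV // mulf_neq0 ?pnatr_eq0 // -lt0n.
have jr i : (i <= m)%N -> 2 * i%:R * r <= 1.
  by move=> im; rewrite -[leRHS]mr ler_wpM2r // ler_wpM2l // ler_nat.
(* This linear bound passes through the induction because [2 * j%:R * r <= 1] absorbs the quadratic
   term. *)
suff : (1 + r) ^+ j <= 1 + 2 * j%:R * r by have := jr j jm; lra.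
elim: j jm => [|j IHj] jm; first by rewrite expr0 mulr0 mul0r addr0.
have := jr j (ltnW jm) => {}jr.
rewrite exprSr; apply: le_trans (_ : (1 + 2 * j%:R * r) * (1 + r) <= _).
  by apply: ler_wpM2r; [lra | exact: IHj (ltnW jm)].
rewrite -natr1.
suff : 2 * j%:R * r * r <= r by lra.
by rewrite -[leRHS]mul1r ler_wpM2r.
Qed.

Lemma norm_prod_le1 (R : realDomainType) (J : Type) (s : seq J) (Q : pred J) (F : J -> R) :
  (forall i, `|F i| <= 1) -> `|\prod_(i <- s | Q i) F i| <= 1.
Proof.
by move=> F1; rewrite normr_prod prodr_ile1 // => i _; rewrite normr_ge0 F1.
Qed.

(** Cauchy-Schwarz over the [k] indices. Since the weights [w] sum to at most 1, the main term [p]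
    is paid once and not [k] times. *)
Lemma sum_sqrt_le (R : rcfType) (k : nat) (F w : nat -> R) (p e : R) :
  0 <= p -> 0 <= e ->
  (forall i, 0 <= w i) -> \sum_(i < k) w i <= 1 ->
  (forall i, F i <= p * w i + e) ->
  \sum_(i < k) Num.sqrt (F i) <= Num.sqrt (k%:R * (p + k%:R * e)).
Proof.
move=> p0 e0 w0 w1 Fw.
have S0 : 0 <= \sum_(i < k) Num.sqrt (F i) by rewrite sumr_ge0.
rewrite -(ger0_norm S0) -sqrtr_sqr ler_wsqrtr //.
apply: le_trans (_ : (\sum_(i < k) Num.sqrt (p * w i + e)) ^+ 2 <= _).
  by rewrite lerXn2r ?nnegrE ?sumr_ge0 //; apply: ler_sum => i _; rewrite ler_wsqrtr.
apply: le_trans (sqr_sum_le_card _ _) _; rewrite card_ord ler_wpM2l //.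
under eq_bigr => i _ do rewrite sqr_sqrtr ?addr_ge0 ?mulr_ge0 //.
rewrite big_split -mulr_sumr /= sumr_const card_ord mulr_natl lerD2r.
by rewrite ler_piMr.
Qed.

Section TwoSided.
Context {R : realType} {n : nat}.
Local Notation cu := (cube 'I_n).
Context (m d : nat) (delta : R) (D T : fdist R cu).
Hypothesis Dd : almost_wise_indep d delta D.
Hypothesis Td : almost_wise_indep d delta T.
Hypothesis m_gt0 : (0 < m)%N.
Hypothesis le_md : (m <= d)%N.

(** The largest threshold with [2 * (a - 1) + m <= d]. *)
Let a := ((d - m)./2).+1.
(** A common bound for the squared Fourier 1-norms of all truncated pieces; the weight used for them
    is [r = (2 * m%:R)^-1]. *)
Let B : R := (2 * m%:R) ^+ d.

Let two_m_ge1 : 1 <= 2 * m%:R :> R.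
Proof. by rewrite -natrM ler1n muln_gt0. Qed.

Section Bounds.
Variables (I : nat -> {set 'I_n}) (G : nat -> cu -> R).
Hypothesis disI : forall i j, i != j -> [disjoint I i & I j].
Hypothesis cardI : forall i, (#|I i| <= m)%N.
Hypothesis depG : forall i, depends_on (I i) (G i).
Hypothesis G_le1 : forall i x, `|G i x| <= 1.

Let c i := fcoef (G i).

Lemma supp_block i : spec_supp (I i) (c i).
Proof. by move=> S; exact: fcoef_eq0. Qed.

Lemma norm_low_block_le i : \sum_S `|low I c a i S| <= (2 * m%:R) ^+ a.-1.
Proof.
rewrite -[2 * m%:R]invrK; apply: norm_low_le => //.
- by rewrite invr_gt0; apply: lt_le_trans two_m_ge1.
- by rewrite invf_le1 //; apply: lt_le_trans two_m_ge1.
move=> l; apply: weighted_norm_fcoef_le (depG l) (G_le1 l) _ _.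
  by rewrite invr_ge0; apply: le_trans two_m_ge1.
exact: exprD1_inv_double_le2.
Qed.

Lemma sqr_norm_low_block_le i : (\sum_S `|low I c a i S|) ^+ 2 <= B.
Proof.
apply: le_trans (_ : ((2 * m%:R) ^+ a.-1) ^+ 2 <= _).
  by rewrite lerXn2r ?nnegrE ?exprn_ge0 ?sumr_ge0 ?norm_low_block_le // mulr_ge0.
by rewrite -exprM ler_weXn2l //= muln2; lia.
Qed.

Lemma sqr_norm_high_block_le i : (\sum_S `|high I c a i S|) ^+ 2 <= B.
Proof.
have le0 : 0 <= (2 * m%:R : R) by rewrite mulr_ge0.
apply: le_trans (_ : ((\sum_S `|low I c a i S|) * (\sum_S `|c i S|)) ^+ 2 <= _).
  by rewrite lerXn2r ?nnegrE ?mulr_ge0 ?sumr_ge0 // norm_high_le.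
(* The untruncated block contributes at most [2 ^+ m <= (2 * m%:R) ^+ m], and the exponents add up
   to [2 * (a - 1) + m <= d]. *)
rewrite exprMn; apply: le_trans (_ : ((2 * m%:R) ^+ a.-1) ^+ 2 * (2 * m%:R) ^+ m <= _).
  apply: ler_pM; rewrite ?sqr_ge0 //.
    by rewrite lerXn2r ?nnegrE ?exprn_ge0 ?sumr_ge0 ?norm_low_block_le.
  apply: le_trans (norm_fcoef_le (I i) (G i) (depG i) (G_le1 i)) _.
  apply: le_trans (_ : 2 ^+ m <= _); first by rewrite ler_weXn2l ?ler1n.
  by rewrite lerXn2r ?nnegrE // ler_peMr // ler1n.
by rewrite -exprM -exprD ler_weXn2l //= muln2; lia.
Qed.

Definition high_moment i : R := expect D (fun x => expect T (fun t =>
  expect_restr x t (spec_eval (high I c a i)) ^+ 2)).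

Lemma high_moment_le i :
  high_moment i <= 2^-1 ^+ a * (\sum_S high I c a i S ^+ 2) + 2 * delta * B.
Proof.
apply: le_trans (expect_restr_sqr_le d delta D T Dd Td a _ _ _) _.
- by move=> S; exact: card_high.
- move=> S S' HS HS'.
  have := card_highU I c a m i S S' (ltn0Sn _) (cardI i) HS HS'.
  by rewrite /a /=; lia.
by rewrite lerD2l ler_wpM2l ?mulr_ge0 ?(delta_ge0 d delta D Dd) ?sqr_norm_high_block_le.
Qed.

Lemma sum_sqrt_high_moment_le k : \sum_(i < k) Num.sqrt (high_moment i) <=
  Num.sqrt (k%:R * (2^-1 ^+ a + k%:R * (2 * delta * B))).
Proof.
apply: (sum_sqrt_le _ k _ (fun i => \sum_S high I c a i S ^+ 2)).
- by rewrite exprn_ge0 // invr_ge0.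
- by rewrite !mulr_ge0 ?(delta_ge0 d delta D Dd) // exprn_ge0 // mulr_ge0.
- by move=> i; rewrite sumr_ge0 // => S _; exact: sqr_ge0.
- by apply: sqr_high_le => i; exact: sqr_fcoef_le.
exact: high_moment_le.
Qed.

End Bounds.

(** The [1 + k] products of degree at most [d] cost [2 * delta * B] each. The products with two high
    parts together cost [k%:R * 2^-1 ^+ a + k%:R ^+ 2 * (2 * delta * B)]. *)
Lemma fooling_error_prod (k : nat) (I : nat -> {set 'I_n}) (G : nat -> cu -> R) :
  (forall i j, i != j -> [disjoint I i & I j]) ->
  (forall i, (#|I i| <= m)%N) ->
  (forall i, depends_on (I i) (G i)) ->
  (forall i x, `|G i x| <= 1) ->
  `|fooling_error D T (fun x => \prod_(i < k) G i x)| <=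
  k%:R * 2^-1 ^+ a + (1 + k%:R + k%:R ^+ 2) * (2 * delta * B).
Proof.
move=> disI cardI depG G1.
(* The blocks in reverse order, so that truncating from the right becomes truncating from the left.
   Beyond [k] they are padded by empty blocks and the constant 1. *)
pose I' l := if (l < k)%N then I (k.-1 - l)%N else finset.set0.
pose G' l := if (l < k)%N then G (k.-1 - l)%N else fun=> 1.
have disI' i j : i != j -> [disjoint I' i & I' j].
  rewrite /I' => ij; case: ifP => ik; last by rewrite -setI_eq0 finset.set0I.
  case: ifP => jk; last by rewrite -setI_eq0 finset.setI0.
  by apply: disI; apply: contra ij => /eqP ij; apply/eqP; lia.
have cardI' i : (#|I' i| <= m)%N by rewrite /I'; case: ifP; rewrite ?cards0.
have depG' i : depends_on (I' i) (G' i) by rewrite /I' /G'; case: ifP.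
have G'1 i x : `|G' i x| <= 1 by rewrite /G'; case: ifP; rewrite ?normr1.
pose lo := low I (fun i => fcoef (G i)) a; pose hi := high I (fun i => fcoef (G i)) a.
pose lo' := low I' (fun i => fcoef (G' i)) a.
pose hi' := high I' (fun i => fcoef (G' i)) a.
have suppI := supp_block I G depG; have suppI' := supp_block I' G' depG'.
have d0 : 0 <= delta := delta_ge0 d delta D Dd.
have B0 : 0 <= B by rewrite exprn_ge0 // mulr_ge0.
have a0 : (0 < a)%N by [].
pose M q j x : R := \prod_(j.+1 <= l < q) G' l x.
(* The blocks after [i] are the first [k.-1 - i] reversed ones. The factor [lo' 0] is the constant
   1, inserted to give the low part the same two-factor form as the middle terms. *)
have expand x : \prod_(i < k) G i x =
    spec_eval (lo k) x * spec_eval (lo' 0%N) x +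
    (\sum_(i < k) spec_eval (hi i) x * spec_eval (lo' (k.-1 - i)%N) x +
     \sum_(i < k) \sum_(j < k.-1 - i)
       spec_eval (hi i) x * (M (k.-1 - i)%N j x * spec_eval (hi' j) x)).
  under eq_bigr => i _ do rewrite -spec_eval_fcoef.
  rewrite (prod_spec_eval _ _ a disI suppI) spec_eval_low0 mulr1; congr (_ + _).
  rewrite -big_split; apply: eq_bigr => i _ /=; rewrite -mulr_sumr -mulrDr.
  congr (_ * _).
  have -> : \prod_(i.+1 <= l < k) spec_eval (fcoef (G l)) x =
            \prod_(l < k.-1 - i) spec_eval (fcoef (G' l)) x.
    rewrite -(big_mkord predT (fun l => spec_eval (fcoef (G' l)) x)).
    rewrite -{1}[i.+1]add0n big_addn big_nat_rev /=.
    have -> : (k - i.+1 = k.-1 - i)%N by lia.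
    apply: eq_big_nat => l lk; rewrite /G' (_ : (l < k)%N); last by lia.
    by rewrite (_ : (0 + _ - _ + _ = k.-1 - l)%N) //; lia.
  rewrite (prod_spec_eval _ _ a disI' suppI'); congr (_ + _); apply: eq_bigr => j _.
  by rewrite mulrC; congr (_ * _); apply: eq_bigr => l _; rewrite spec_eval_fcoef.
rewrite (eq_fooling_error _ _ _ _ expand) !fooling_errorD !fooling_error_sum.
under [X in _ + (_ + X)]eq_bigr => i _ do rewrite fooling_error_sum.
(* The arithmetic-geometric mean inequality turns bounds on squared norms into a bound on their
   product. *)
have mulB (u v : R) : 0 <= u -> 0 <= v -> u ^+ 2 <= B -> v ^+ 2 <= B -> u * v <= B.
  move=> u0 v0 uB vB; have := sqr_ge0 (u - v); rewrite sqrrB.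
  by move: uB vB; rewrite mulr2n; lra.
have low_part : `|fooling_error D T (fun x => spec_eval (lo k) x * spec_eval (lo' 0%N) x)|
    <= 2 * delta * B.
  apply: le_trans (fooling_error_low_degree d delta D T Dd _ _ _) _.
    move=> S S' /(card_low _ _ _ _ _ a0) Sa /(card_low _ _ _ _ _ a0) S'a.
    have := (leq_card_setU S S').1; move: Sa S'a; rewrite /a.
    by move: le_md; lia.
  rewrite ler_wpM2l ?mulr_ge0 // mulB ?sumr_ge0 //.
    exact: sqr_norm_low_block_le.
  exact: sqr_norm_low_block_le.
(* A set from [hi i] has at most [(a - 1) + m] elements and one from [lo'] at most [a - 1], so their
   union has at most [d]. *)
have mid_part (i : 'I_k) :
    `|fooling_error D T (fun x => spec_eval (hi i) x * spec_eval (lo' (k.-1 - i)%N) x)|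
    <= 2 * delta * B.
  apply: le_trans (fooling_error_low_degree d delta D T Dd _ _ _) _.
    move=> S S' HS /(card_low _ _ _ _ _ a0) S'a.
    have := card_highU I _ a m i S S a0 (cardI i) HS HS; rewrite finset.setUid.
    have := card_highD I _ a i S a0 HS.
    have := subset_leq_card (subsetIr S (I i)); have := cardI i.
    have := cardsID (I i) S.
    have := (leq_card_setU S S').1; move: S'a; rewrite /a.
    by move: le_md; lia.
  rewrite ler_wpM2l ?mulr_ge0 // mulB ?sumr_ge0 //.
    exact: sqr_norm_high_block_le.
  exact: sqr_norm_low_block_le.
pose v : R := k%:R * (2^-1 ^+ a + k%:R * (2 * delta * B)).
have v0 : 0 <= v.
  by rewrite mulr_ge0 // addr_ge0 ?exprn_ge0 ?invr_ge0 ?mulr_ge0.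
have high_part (i : 'I_k) (j : 'I_(k.-1 - i)) :
    `|fooling_error D T (fun x => spec_eval (hi i) x *
        (M (k.-1 - i)%N j x * spec_eval (hi' j) x))| <=
    Num.sqrt (high_moment I G i) * Num.sqrt (high_moment I' G' j).
  have ij := ltn_ord j.
  have disAI l : (l < k.-1 - i)%N -> [disjoint first_blocks I i.+1 & I' l].
    move=> lq; apply: disjoint_first_blocks => l' l'i; rewrite /I' (_ : (l < k)%N); last by lia.
    by apply: disI; apply/eqP; lia.
  have disAC : [disjoint first_blocks I' j.+1 & first_blocks I i.+1].
    apply: disjoint_first_blocks => l lj; rewrite disjoint_sym; apply: disAI.
    by move: lj ij; lia.
  (* The middle factor is assigned all coordinates outside the two outer groups of blocks, so the
     right one is supported on the complement of the union by construction. *)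
  apply: (fooling_error_high_degree D T (first_blocks I i.+1)
    (~: (first_blocks I i.+1 :|: first_blocks I' j.+1))).
  - exact: supp_high.
  - move=> x y xy; apply: eq_big_nat => l /andP[jl lq]; apply: (depG' l) => z zI.
    apply: xy; move: z zI; apply/fintype.subsetP.
    rewrite finset.setCU finset.subsetI -!finset.disjoints_subset.
    rewrite disjoint_sym disAI //= disjoint_sym; apply: disjoint_first_blocks => l' l'j.
    by apply: disI'; apply/eqP; move: l'j jl; lia.
  - move=> S SC; apply: (supp_high I' _ a suppI' j); apply: contra SC => SC.
    apply: fintype.subset_trans SC _; rewrite finset.setCU finset.setCK finset.subsetI.
    by rewrite finset.subsetUr andbT -finset.disjoints_subset.
  - by rewrite finset.disjoints_subset finset.setCK finset.subsetUl.
  - exact: high_set0.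
  - by move=> x; apply: norm_prod_le1.
apply: le_trans (ler_normD _ _) _; rewrite !mulrDl mul1r addrC -!addrA.
apply: le_trans (_ : (k%:R * (2 * delta * B) + v) + 2 * delta * B <= _); last first.
  by rewrite /v le_eqVlt; apply/orP; left; apply/eqP; ring.
apply: lerD; last exact: low_part.
apply: le_trans (ler_normD _ _) _; apply: lerD.
  apply: le_trans (ler_norm_sum _ _ _) _.
  apply: le_trans (ler_sum _ (fun i _ => mid_part i)) _.
  by rewrite sumr_const card_ord -[leLHS]mulr_natl.
apply: le_trans (ler_norm_sum _ _ _) _.
(* For each [i] the sum over [j] is extended to all [j < k] and bounded by [Num.sqrt v]; the sum
   over [i] then gives a second [Num.sqrt v]. *)
apply: le_trans (_ : \sum_(i < k) Num.sqrt (high_moment I G i) * Num.sqrt v <= _).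
  apply: ler_sum => i _; apply: le_trans (ler_norm_sum _ _ _) _.
  apply: le_trans (ler_sum _ (fun j _ => high_part i j)) _.
  rewrite -mulr_sumr ler_wpM2l //.
  apply: le_trans (sum_sqrt_high_moment_le I' G' cardI' depG' G'1 k).
  rewrite (big_ord_widen k (fun j => Num.sqrt (high_moment I' G' j))); last by lia.
  rewrite [leRHS](bigID (fun j : 'I_k => (j < k.-1 - i)%N)) /= lerDl.
  by rewrite sumr_ge0.
rewrite -mulr_suml -[leRHS](sqr_sqrtr v0) expr2 ler_wpM2r //.
exact: sum_sqrt_high_moment_le.
Qed.

End TwoSided.

(** Passes to blocks indexed by all natural numbers: indices from [k] on get the empty set and the
    constant 1, which keeps every condition true. *)
Lemma product_test_blocks (R : realType) (n k m : nat) (f : cube 'I_n -> R) :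
  product_test k m f ->
  exists (I : nat -> {set 'I_n}) (G : nat -> cube 'I_n -> R),
    [/\ forall i j, i != j -> [disjoint I i & I j],
        forall i, (#|I i| <= m)%N,
        forall i, depends_on (I i) (G i),
        forall i x, `|G i x| <= 1
      & forall x, f x = \prod_(i < k) G i x].
Proof.
move=> [I [g [disI cardI g1 fE]]].
exists (fun l => oapp I finset.set0 (insub l)).
exists (fun l x => oapp (fun i => g i (restr (I i) x)) 1 (insub l)); split.
- move=> i j ij; case: insubP => [i' _ i'i|_] /=; last by rewrite -setI_eq0 finset.set0I.
  case: insubP => [j' _ j'j|_] /=; last by rewrite -setI_eq0 finset.setI0.
  by apply: disI; apply: contra ij => /eqP ij; rewrite -i'i -j'j ij.
- by move=> i; case: insubP => [i' _ _|_] /=; rewrite ?cards0.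
- move=> i x y; case: insubP => [i' _ _|_] //= xy; congr (g i' _).
  by apply/ffunP => j; rewrite !ffunE; apply: xy; exact: valP j.
- move=> i x; case: insubP => [i' _ _|_] /=; last by rewrite normr1.
  by rewrite ler_norml.
by move=> x; rewrite fE; apply: eq_bigr => i _; rewrite valK.
Qed.

(** * Direct character-by-character bounds, for the case that [m] exceeds [d] *)

Section Crude.
Context {R : realType} {n : nat}.
Local Notation cu := (cube 'I_n).
Context (d : nat) (delta : R) (D T : fdist R cu).

Lemma expect_xor_andE (f : cu -> R) :
  expect (indep_prod D (indep_prod T (unif R 'I_n)))
    (fun w => f (bitxor w.1 (bitand w.2.1 w.2.2))) = expect_xor_and D T f.
Proof.
by rewrite expect_indep_prod; apply: eq_expect => x; rewrite expect_indep_prod.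
Qed.

Lemma fooling_error_cst (v : R) : fooling_error D T (fun=> v) = 0.
Proof.
by rewrite /fooling_error /expect_xor_and /expect_restr !expect_cst subrr.
Qed.

Lemma fooling_error_le2 (f : cu -> R) :
  (forall x, `|f x| <= 1) -> `|fooling_error D T f| <= 2.
Proof.
move=> f1; apply: le_trans (ler_normB _ _) _; apply: (@lerD _ _ 1 _ 1);
  last exact: norm_expect_le.
by do 2!apply: norm_expect_le => ?; apply: norm_expect_le => u; exact: f1.
Qed.

Hypothesis Dd : almost_wise_indep d delta D.
Hypothesis Td : almost_wise_indep d delta T.

(** Up to size [d] the distribution D fools the character. A larger [S] contains some [S'] of size
    [d], and survival of [S] implies survival of [S'], to which the independence of T applies. *)
Lemma fooling_error_chi_le (S : {set 'I_n}) :
  `|fooling_error D T (chi S)| <= 2^-1 ^+ d + 2 * delta.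
Proof.
have [Sd|dS] := leqP #|S| d.
  rewrite (eq_fooling_error _ _ _ (fun x => chi S x * chi finset.set0 x)); last first.
    by move=> x; rewrite chi_set0 mulr1.
  apply: le_trans (fooling_error_chiM d delta D T Dd _ _ _) _; first by rewrite finset.setU0.
  by rewrite lerDr exprn_ge0 // invr_ge0.
have [S' S'S S'd] : exists2 S' : {set 'I_n}, S' \subset S & #|S'| = d.
  exists [set j in take d (enum S)].
    by apply/fintype.subsetP => j; rewrite inE => /mem_take; rewrite mem_enum.
  rewrite cardsE; move/card_uniqP: (take_uniq d (enum_uniq S)) => ->.
  by rewrite size_takel // -cardE ltnW.
have S0 : S != finset.set0 by rewrite -card_gt0 (leq_ltn_trans _ dS).
rewrite /fooling_error unif_chi (negbTE S0) subr0.
have -> : expect_xor_and D T (chi S) = expect D (chi S) * expect T (alive S).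
  rewrite -expectZr; apply: eq_expect => x; rewrite -expectZl.
  by apply: eq_expect => t; exact: expect_restr_chi.
have aT0 : 0 <= expect T (alive S) :> R.
  by rewrite -(expect_cst T 0); apply: le_expect => t; exact: alive_ge0.
rewrite normrM (ger0_norm aT0); apply: le_trans (_ : expect T (alive S) <= _).
  by rewrite ler_piMl // norm_expect_le // => x; rewrite normr_chi.
rewrite -S'd; apply: le_trans (almost_alive d delta T Td S' _); last by rewrite S'd.
apply: le_expect => t; rewrite /alive.
have [E|_] := eqVneq [set j in S | t j] finset.set0; last exact: ler0n.
rewrite (_ : [set j in S' | t j] == finset.set0) // -finset.subset0 -E.
by apply/fintype.subsetP => j; rewrite !inE => /andP[/(fintype.subsetP S'S) -> ->].
Qed.

(** The error is at most the Fourier 1-norm times the worst error of a character; squaring avoids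
    the root of [2 ^+ #|A|]. *)
Lemma fooling_error_fourier_le (A : {set 'I_n}) (g : cu -> R) :
  depends_on A g -> (forall x, `|g x| <= 1) ->
  fooling_error D T g ^+ 2 <= 2 ^+ #|A| * (2^-1 ^+ d + 2 * delta) ^+ 2.
Proof.
move=> gA g1; set b := 2^-1 ^+ d + 2 * delta.
have b0 : 0 <= b := le_trans (normr_ge0 _) (fooling_error_chi_le finset.set0).
apply: le_trans (_ : ((\sum_S `|fcoef g S|) * b) ^+ 2 <= _); last first.
  by rewrite exprMn ler_wpM2r ?sqr_ge0 // norm_fcoef_le.
rewrite -real_normK ?num_real // lerXn2r ?nnegrE ?mulr_ge0 ?sumr_ge0 //.
rewrite (eq_fooling_error _ _ _ _ (fourier_inversion g)) fooling_error_sum.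
apply: le_trans (ler_norm_sum _ _ _) _; rewrite mulr_suml; apply: ler_sum => S _.
by rewrite fooling_errorZl normrM ler_wpM2l // fooling_error_chi_le.
Qed.

End Crude.

(** * Case distinction on [k], [m] and [d], and the final constants *)

Theorem theorem1p11 (R : realType) (n k m d : nat) (delta : R)
    (f : cube 'I_n -> R) (D T : fdist R (cube 'I_n)) :
  product_test k m f ->
  (0 < d)%N ->
  almost_wise_indep d delta D ->
  almost_wise_indep d delta T ->
  `| expect (indep_prod D (indep_prod T (unif R 'I_n)))
       (fun w => f (bitxor w.1 (bitand w.2.1 w.2.2)))
     - expect (unif R 'I_n) f |
  <= k%:R * (Num.sqrt delta *
               (170 * Num.sqrt (m%:R * ln (expR 1 * k%:R))) ^+ d
             + 2 `^ (- (d%:R - m%:R) / 2)).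
Proof.
move=> /product_test_blocks[I [G [disI cardI depG G1 fE]]] d0 Dd Td.
rewrite expect_xor_andE -/(fooling_error D T f).
have delta0 := delta_ge0 d delta D Dd.
set s := Num.sqrt delta; set L := ln _; set X := (170 * _) ^+ d; set P := 2 `^ _.
have s0 : 0 <= s := sqrtr_ge0 _.
have sE : s ^+ 2 = delta := sqr_sqrtr delta0.
have X0 : 0 <= X by rewrite exprn_ge0 // mulr_ge0 // sqrtr_ge0.
have P0 : 0 <= P := powR_ge0 _ _.
have rhs0 : 0 <= k%:R * (s * X + P) by rewrite mulr_ge0 // addr_ge0 // mulr_ge0.
have [k0|k_gt0] := posnP k.
  rewrite (eq_fooling_error _ _ _ (fun=> 1)) ?fooling_error_cst ?normr0 // => x.
  by rewrite fE; move: (k0) => ->; rewrite big_ord0.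
have [m0|m_gt0] := posnP m.
  rewrite (eq_fooling_error _ _ _ (fun=> f [ffun=> false])) ?fooling_error_cst ?normr0 // => x.
  rewrite !fE; apply: eq_bigr => i _; apply: depG => j.
  by have := cardI i; rewrite m0 leqn0 cards_eq0 => /eqP ->; rewrite inE.
(* The error never exceeds 2, so the right-hand side may be assumed below 2; this bounds both
   [k%:R * s * X] and [k%:R * P] by 2. *)
have [rhs2|rhs2] := leP 2 (k%:R * (s * X + P)).
  apply: le_trans rhs2; apply: fooling_error_le2 => x; rewrite fE.
  exact: norm_prod_le1.
have k1 : 1 <= k%:R :> R by rewrite ler1n.
have m1 : 1 <= m%:R :> R by rewrite ler1n.
have L1 : 1 <= L.
  rewrite /L lnM ?posrE ?expR_gt0 ?ltr0n // expRK lerDl.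
  exact: ln_ge0.
have XX : (10 ^+ 2 * m%:R) ^+ d <= X ^+ 2.
  have L0 : 0 <= L := le_trans ler01 L1.
  have mL0 : 0 <= m%:R * L by rewrite mulr_ge0.
  have -> : X ^+ 2 = (170 ^+ 2 * (m%:R * L)) ^+ d.
    by rewrite /X exprAC [(170 * _) ^+ 2]exprMn sqr_sqrtr.
  rewrite lerXn2r ?nnegrE ?mulr_ge0 ?exprn_ge0 //.
  apply: ler_pM; rewrite ?exprn_ge0 ?ler_peMr //.
  by rewrite lerXn2r ?nnegrE // ler_nat.
have X_gt0 : 0 < X.
  rewrite lt_def X0 andbT; apply/eqP => X_eq0; move: XX; rewrite X_eq0 expr0n /=.
  by rewrite leNgt exprn_gt0 // mulr_gt0 // (lt_le_trans _ m1).
have ksX : k%:R * s * X < 2.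
  by apply: le_lt_trans rhs2; rewrite mulrDr mulrA lerDl mulr_ge0.
have kP : k%:R * P < 2.
  by apply: le_lt_trans rhs2; rewrite mulrDr lerDr !mulr_ge0.
have [md|dm] := leqP m d.
  apply: le_trans (_ : `|fooling_error D T (fun x => \prod_(i < k) G i x)| <= _).
    by rewrite (eq_fooling_error _ _ _ _ fE).
  apply: le_trans
    (fooling_error_prod m d delta D T Dd Td m_gt0 md k I G disI cardI depG G1) _.
  rewrite addrC mulrDr; apply: lerD; last first.
    (* Despite the rounding in the halving, [2 * a >= d - m], hence [2^-1 ^+ a <= P]. *)
    rewrite ler_wpM2l // -powR_mulrn ?invr_ge0 // -powR_inv1 // -powRrM.
    rewrite ler_powR ?ler1n // mulN1r.
    have : (d <= m + (d - m)./2.+1.*2)%N by move: md; lia.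
    by rewrite -(ler_nat R) natrD -muln2 natrM; lra.
  set B := _ ^+ d.
  have B0 : 0 <= B by rewrite exprn_ge0 // mulr_ge0.
  have BX : 12 * B <= X ^+ 2.
    apply: le_trans XX; rewrite (_ : 10 ^+ 2 * m%:R = 50 * (2 * m%:R)); last by ring.
    rewrite exprMn ler_wpM2r //; apply: le_trans (_ : 50 ^+ 1 <= _).
      by rewrite expr1; lra.
    by rewrite ler_weXn2l // ler1n.
  (* After multiplication by [X] this follows from [k%:R * s * X < 2] and [12 * B <= X ^+ 2]. It
     trades one factor [s] of [delta = s ^+ 2], together with [B], for [X]; the 6 is 2 times the 3
     in [1 + k + k^2 <= 3 * k^2]. *)
  have key : 6 * (k%:R * s) * B <= X.
    rewrite -(ler_pM2r X_gt0) -expr2; apply: le_trans BX.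
    rewrite (_ : 6 * _ * B * X = 6 * B * (k%:R * s * X)); last by ring.
    by rewrite (_ : 12 * B = 6 * B * 2); [rewrite ler_wpM2l ?mulr_ge0 // ltW | ring].
  apply: le_trans (_ : k%:R * s * (6 * (k%:R * s) * B) <= _); last first.
    by rewrite [leRHS]mulrA ler_wpM2l ?mulr_ge0.
  rewrite -sE (_ : k%:R * s * _ = 3 * k%:R ^+ 2 * (2 * s ^+ 2 * B)); last by ring.
  rewrite ler_wpM2r ?mulr_ge0 ?sqr_ge0 //.
  have : k%:R <= k%:R ^+ 2 :> R by rewrite expr2 ler_peMr.
  by move: k1; lra.
(* Here [m > d], and [k%:R * P < 2] leaves only [k = 1] and [m = d.+1], where [P] is the square root
   of 2. It then suffices that the squared error of the single block is at most 2. *)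
have P1 : 1 <= P.
  rewrite -(powRr0 2) ler_powR ?ler1n //.
  by move: dm; rewrite -(ltr_nat R); lra.
have kE : k = 1%N.
  apply/eqP; rewrite eqn_leq k_gt0 andbT leqNgt; apply/negP => k2.
  have : 2 <= k%:R :> R by rewrite ler_nat.
  by move: kP P1; nra.
have mE : m = d.+1.
  apply/eqP; rewrite eqn_leq dm andbT leqNgt; apply/negP => dm2.
  have : 2 <= P.
    rewrite -{1}(powRr1 (ler0n R 2)) ler_powR ?ler1n //.
    by move: dm2; rewrite -(ler_nat R) -natr1 -natr1; lra.
  by move: kP; rewrite kE mul1r; lra.
have PE : P ^+ 2 = 2.
  rewrite /P mE -natr1 (_ : _ / 2 = 2^-1); last by field.
  by rewrite powR12_sqrt // sqr_sqrtr.
apply: le_trans (_ : k%:R * P <= _); last by rewrite ler_wpM2l // lerDr mulr_ge0.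
rewrite kE mul1r -[leRHS](ger0_norm P0) -ler_sqr ?nnegrE // !real_normK ?num_real //.
rewrite PE; have fG : f =1 G 0%N by move=> x; rewrite fE kE big_ord1.
rewrite (eq_fooling_error _ _ _ _ fG).
apply: le_trans (fooling_error_fourier_le d delta D T Dd Td _ _ (depG 0%N) (G1 0%N)) _.
apply: le_trans (_ : 2 ^+ m * (2^-1 ^+ d + 2 * delta) ^+ 2 <= _).
  by rewrite ler_wpM2r ?sqr_ge0 // ler_weXn2l // ler1n.
have u0 : 0 < 2^-1 ^+ d :> R by rewrite exprn_gt0 // invr_gt0.
have uE : 2 ^+ d * 2^-1 ^+ d = 1 :> R by rewrite -exprMn mulfV ?expr1n // pnatr_eq0.
have u2 : 2^-1 ^+ d <= 2^-1 :> R.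
  by rewrite -[leRHS]expr1 ler_wiXn2l // ?invr_ge0 // invf_le1 // ler1n.
(* From [s * X < 2] one has [delta * X ^+ 2 <= 4], while [X ^+ 2 >= 50 * 2 ^+ d]; so [delta] is at
   most 4/50 of [2^-1 ^+ d], which is below one twelfth. *)
have du : delta * 12 <= 2^-1 ^+ d.
  have sX : s * X < 2 by move: ksX; rewrite kE mul1r.
  have : delta * X ^+ 2 <= 4.
    rewrite -sE -exprMn (_ : 4 = 2 ^+ 2); last by rewrite -natrX.
    by rewrite lerXn2r ?nnegrE ?mulr_ge0 // ltW.
  have : 50 * 2 ^+ d <= X ^+ 2.
    apply: le_trans XX; apply: le_trans (_ : 50 ^+ d * 2 ^+ d <= _).
      by rewrite ler_wpM2r ?exprn_ge0 // -[leLHS]expr1 ler_weXn2l // ler1n.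
    by rewrite -exprMn lerXn2r ?nnegrE ?mulr_ge0 ?exprn_ge0 //; lra.
  move=> X2 dX; have : delta * (50 * 2 ^+ d) <= 4.
    by apply: le_trans dX; rewrite ler_wpM2l.
  move/(ler_wpM2r (ltW u0)); rewrite -!mulrA uE mulr1.
  by move: delta0; lra.
(* With [u = 2^-1 ^+ d], the bounds [2 * delta <= u / 6] and [u <= 1/2] give
   [(u + 2 * delta) ^+ 2 <= u], and [2 ^+ d.+1 * u = 2]. *)
rewrite mE exprS.
have : (2^-1 ^+ d + 2 * delta) ^+ 2 <= 2^-1 ^+ d :> R by nra.
have : 0 <= 2 ^+ d :> R by rewrite exprn_ge0.
by move: uE; nra.
Qed.
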